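(* The Tribonacci sequence is $3$-pseudoperiodic, but not $2$-pseudoperiodic.
   Context: The Tribonacci sequence is the infinite fixed point, starting with $0$, of the morphism $0\mapsto01$, $1\mapsto02$, $2\mapsto0$; it is indexed from $0$. For integers $k\ge1$ and $0<p_1<\cdots<p_k$, an infinite word $\mathbf{s}$ has pseudoperiod $(p_1,\ldots,p_k)$ if $\mathbf{s}[i]\in\{\mathbf{s}[i+p_1],\ldots,\mathbf{s}[i+p_k]\}$ for all $i\ge0$; it is $k$-pseudoperiodic if it has some pseudoperiod with exactly $k$ entries. *)

(* Defs.v *)
From mathcomp Require Import all_boot.

Set Implicit Arguments.
Unset Strict Implicit.
Unset Printing Implicit Defensive.

Definition infword (T : Type) := nat -> T.

(* The extension of a letter map f to the free monoid on finite words. *)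
Definition morph (A B : Type) (f : A -> seq B) (u : seq A) : seq B :=
  flatten (map f u).

(* v = f(w) for a nonerasing f: the image of each prefix of w is a prefix of
   v. The images of the prefixes have unbounded length, so v is determined. *)
Definition morph_image (A B : Type) (f : A -> seq B)
    (w : infword A) (v : infword B) : Prop :=
  forall n, let u := morph f (mkseq w n) in u = mkseq v (size u).

Definition fixed_point (A : Type) (f : A -> seq A) (w : infword A) : Prop :=
  morph_image f w w.

Definition l0 : 'I_3 := @Ordinal 3 0 isT.
Definition l1 : 'I_3 := @Ordinal 3 1 isT.
Definition l2 : 'I_3 := @Ordinal 3 2 isT.

Definition trib_morph (a : 'I_3) : seq 'I_3 :=
  if a == l0 then [:: l0; l1]
  else if a == l1 then [:: l0; l2]
  else [:: l0].

Definition is_tribonacci (t : infword 'I_3) : Prop :=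
  fixed_point trib_morph t /\ t 0 = l0.

(* path ltn 0 [:: p_1; ...; p_k] unfolds to 0 < p_1 < ... < p_k. *)
Definition has_pseudoperiod (T : eqType) (s : infword T) (p : seq nat) : Prop :=
  [/\ 0 < size p, path ltn 0 p &
      forall i, s i \in [seq s (i + q) | q <- p]].

Definition pseudoperiodic (T : eqType) (k : nat) (s : infword T) : Prop :=
  exists p : seq nat, size p = k /\ has_pseudoperiod s p.

(* The lemmas below show that is_tribonacci holds of exactly one word. *)

Lemma morph_cat (A B : Type) (f : A -> seq B) u v :
  morph f (u ++ v) = morph f u ++ morph f v.
Proof. by rewrite /morph map_cat flatten_cat. Qed.

Lemma size_trib_morph u : size u <= size (morph trib_morph u).
Proof.
elim: u => //= a u IH; rewrite [morph _ _]/(_ ++ morph _ u) size_cat -add1n.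
by apply: leq_add IH; rewrite /trib_morph; case: ifP => // _; case: ifP.
Qed.

Lemma size_trib_morph0 u :
  (size u).+1 < size (morph trib_morph (l0 :: u)).
Proof.
have -> : morph trib_morph (l0 :: u) = [:: l0, l1 & morph trib_morph u] by [].
by rewrite /= !ltnS size_trib_morph.
Qed.

Definition trib_prefix n := iter n (morph trib_morph) [:: l0].

Lemma trib_prefixE n :
  trib_prefix n.+1 = morph trib_morph (trib_prefix n).
Proof. by []. Qed.

Lemma trib_prefixS n : exists v, trib_prefix n.+1 = trib_prefix n ++ v.
Proof.
elim: n => [|n [v Ev]]; first by exists [:: l1].
exists (morph trib_morph v).
by rewrite trib_prefixE {1}Ev morph_cat -trib_prefixE.
Qed.

Lemma trib_prefixD n m : exists v, trib_prefix (m + n) = trib_prefix n ++ v.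
Proof.
elim: m => [|m [v Ev]]; first by exists [::]; rewrite cats0.
have [w Ew] := trib_prefixS (m + n).
by exists (v ++ w); rewrite addSn Ew Ev catA.
Qed.

Lemma trib_prefix_cons n : exists u, trib_prefix n = l0 :: u.
Proof. by have [v] := trib_prefixD 0 n; rewrite addn0 => ->; exists v. Qed.

Lemma size_trib_prefix n : n < size (trib_prefix n).
Proof.
elim: n => // n IH; rewrite trib_prefixE.
have [u Eu] := trib_prefix_cons n; rewrite Eu in IH *.
exact: leq_ltn_trans IH (size_trib_morph0 u).
Qed.

Definition trib_word : infword 'I_3 := fun i => nth l0 (trib_prefix i) i.

Lemma trib_wordE i m : i < size (trib_prefix m) ->
  trib_word i = nth l0 (trib_prefix m) i.
Proof.
move=> lt_im; rewrite /trib_word; case/orP: (leq_total i m) => le.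
  have [v] := trib_prefixD i (m - i); rewrite subnK // => ->.
  by rewrite nth_cat size_trib_prefix.
have [v] := trib_prefixD m (i - m); rewrite subnK // => ->.
by rewrite nth_cat lt_im.
Qed.

Lemma trib_word_take n m : n <= size (trib_prefix m) ->
  mkseq trib_word n = take n (trib_prefix m).
Proof.
move=> le_nm; apply: (@eq_from_nth _ l0).
  by rewrite size_mkseq size_takel.
move=> i; rewrite size_mkseq => lt_in; rewrite nth_mkseq // nth_take //.
by apply: trib_wordE; apply: leq_trans le_nm.
Qed.

Lemma trib_word_tribonacci : is_tribonacci trib_word.
Proof.
split=> // n u.
have Eu : trib_prefix n.+1 = u ++ morph trib_morph (drop n (trib_prefix n)).
  rewrite /u (@trib_word_take n n) ?(ltnW (size_trib_prefix _)) //.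
  by rewrite -morph_cat cat_take_drop.
by rewrite (@trib_word_take _ n.+1) Eu ?size_cat ?leq_addr // take_size_cat.
Qed.

Lemma tribonacci_unique s t : is_tribonacci s -> is_tribonacci t -> s =1 t.
Proof.
move=> [fs s0] [ft t0].
suff E n : mkseq s n.+1 = mkseq t n.+1.
  move=> i; have := congr1 (fun u => nth l0 u i) (E i).
  by rewrite /= !nth_mkseq.
elim: n => [|n IH]; first by rewrite /mkseq /= s0 t0.
have := ft n.+1; have := fs n.+1; rewrite /= IH.
set u := morph _ _ => Es Et.
have lt_nu : n.+1 < size u.
  rewrite /u; have -> : mkseq t n.+1 = t 0 :: map t (iota 1 n) by [].
  rewrite t0.
  have := size_trib_morph0 (map t (iota 1 n)).
  by rewrite size_map size_iota.
have take_mk (w : infword 'I_3) : take n.+2 (mkseq w (size u)) = mkseq w n.+2.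
  by rewrite /mkseq -map_take take_iota; congr (map _ (iota _ _)); apply/minn_idPl.
by rewrite -!take_mk -Es -Et.
Qed.

(* Main.v *)
Require Import Defs.
From mathcomp Require Import all_boot.

Set Implicit Arguments.
Unset Strict Implicit.
Unset Printing Implicit Defensive.

(* Every prefix u of the Tribonacci word is left special with all three
   extensions: 00, 10 and 20 are factors, and if b u is a factor then so is
   c phi(u), where c is the last letter of phi(b); b |-> c is a permutation
   of the letters. If (p, q) were a pseudoperiod, pick a letter a different from
   t[p-1] and t[q-1] and an occurrence of a t[0..q) at some i; then
   t[i] = a differs from t[i+p] = t[p-1] and t[i+q] = t[q-1].
   That (4, 6, 7) is a pseudoperiod only depends on the factors of length 8,
   and a finite set of words containing them all is found by closing under the
   morphism. *)

(** Occurrences are recorded as ends of prefixes, because [fixed_point] speaks of prefixes only. *)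
Definition factor (T : Type) (t : infword T) (u : seq T) : Prop :=
  exists w n, mkseq t n = w ++ u.

Lemma factor_nth {T : Type} {t : infword T} {u : seq T} : factor t u ->
  exists i, forall k x0, k < size u -> t (i + k) = nth x0 u k.
Proof.
case=> w [n E]; exists (size w) => k x0 ku.
have szn : n = size w + size u by rewrite -size_cat -E size_mkseq.
rewrite -(@nth_mkseq _ x0 t n) ?szn ?ltn_add2l // -szn E nth_cat.
by rewrite ltnNge leq_addr /= addKn.
Qed.

Lemma factor_morph (T : Type) (f : T -> seq T) (t : infword T) u :
  fixed_point f t -> factor t u -> factor t (morph f u).
Proof.
move=> ft [w [n E]]; exists (morph f w), (size (morph f (mkseq t n))).
by rewrite -morph_cat -E -(ft n).
Qed.

Lemma factor_suffix (T : Type) (t : infword T) u v :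
  factor t (u ++ v) -> factor t v.
Proof. by case=> w [n E]; exists (w ++ u), n; rewrite -catA. Qed.

Lemma letterP (P : 'I_3 -> Prop) : P l0 -> P l1 -> P l2 -> forall a, P a.
Proof.
by move=> P0 P1 P2 [[|[|[|//]]] lt_i];
  [move: P0 | move: P1 | move: P2]; congr P; apply: val_inj.
Qed.

Lemma trib_prefix_left_special a n :
  factor trib_word (a :: trib_prefix n).
Proof.
have [fix_t _] := trib_word_tribonacci.
elim: n a => [|n IH].
  (* The word begins with 01020100, whose prefixes of lengths 8, 3 and 5 end in 00, 10 and 20. *)
  by apply: letterP; [exists (mkseq trib_word 6), 8 | exists [:: l0], 3
    | exists (mkseq trib_word 3), 5]; vm_compute.
have step b : factor trib_word (trib_morph b ++ trib_prefix n.+1).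
  exact: factor_morph (IH b).
by apply: letterP; [exact: step l2 | exact: (@factor_suffix _ _ [:: l0]) (step l0)
  | exact: (@factor_suffix _ _ [:: l0]) (step l1)].
Qed.

Lemma letter_avoid2 (b c : 'I_3) : exists a, (a != b) && (a != c).
Proof.
by move: b c; apply: letterP; apply: letterP;
  (exists l0; by []) || (exists l1; by []) || (exists l2; by []).
Qed.

Lemma trib_word_not_2pseudoperiodic : ~ pseudoperiodic 2 trib_word.
Proof.
case=> [[|p [|q [|? ?]]]] [] // _ [_ /= /and3P [p0 lt_pq _] H].
have [a /andP [ab ac]] := letter_avoid2 (trib_word p.-1) (trib_word q.-1).
have [i Hi] := factor_nth (trib_prefix_left_special a q).
(* The extra letter [a] in front of the prefix moves all indices by one. *)
have shift k : 0 < k <= q -> trib_word (i + k) = trib_word k.-1.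
  case: k => //= k lt_kq.
  have lt_k : k < size (trib_prefix q).
    exact: leq_trans lt_kq (ltnW (size_trib_prefix q)).
  by rewrite (Hi _ l0) //= (@trib_wordE _ q).
have := H i; rewrite !inE shift ?p0 ?(ltnW lt_pq) // shift ?leqnn ?(ltn_trans p0) //.
by rewrite -{1 2}[i]addn0 (Hi 0 l0) //= (negPf ab) (negPf ac).
Qed.

(** Since no letter is erased, the first [L] letters of [u] already produce [L] letters of the
    image, if there are that many. *)
Lemma take_morph (A B : Type) (f : A -> seq B) L u :
  (forall a, 0 < size (f a)) ->
  take L (morph f u) = take L (morph f (take L u)).
Proof.
move=> f_gt0; elim: u L => [|a u IH] [|L] //; first by rewrite !take0.
have morph_cons v : morph f (a :: v) = f a ++ morph f v by [].
have fa := f_gt0 a; rewrite /= !morph_cons !take_cat.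
case: ltnP => // le_aL; congr (_ ++ _).
have le : L.+1 - size (f a) <= L by rewrite leq_subLR -add1n leq_add2r.
by rewrite -[RHS](take_takel _ le) -IH take_takel.
Qed.

Lemma trib_morph_gt0 a : 0 < size (trib_morph a).
Proof. by move: a; apply: letterP. Qed.

(* Truncated windows at the end of a word are included, hence all lengths
   up to L. *)
Definition windows (T : Type) L (u : seq T) : seq (seq T) :=
  [seq take k (drop i u) | i <- iota 0 (size u), k <- iota 0 L.+1].

Definition windows_in (T : eqType) L (F : seq (seq T)) (u : seq T) : Prop :=
  forall i, take L (drop i u) \in F.

(** Images of letters have length at most 2, so a window of an image starts at the first or second
    letter of such a block; [[::]] serves positions past the end. *)
Definition trib_closed L (F : seq (seq 'I_3)) : bool :=
  ([::] \in F) && all (fun v => (take L (morph trib_morph v) \in F)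
                && (take L (behead (morph trib_morph v)) \in F)) F.

(** Induction on [u]: closure settles the windows that start inside the image of the first letter,
    and later ones lie in the image of the tail. *)
Lemma windows_in_morph L F u : trib_closed L.+1 F ->
  windows_in L.+1 F u -> windows_in L.+1 F (morph trib_morph u).
Proof.
move=> /andP [F0 /allP clF]; elim: u => [|a u IH] Fu i; first by rewrite /morph.
have {}IH := IH (fun i => Fu i.+1).
have /andP [] := clF _ (Fu 0); rewrite drop0 -take_morph; last exact: trib_morph_gt0.
case: i => [|i]; first by rewrite drop0.
move=> _; rewrite /= -[a :: take L u]cat1s -[a :: u]cat1s !morph_cat.
move: a {Fu}; apply: letterP => /= W1; last exact: IH.
- case: i => [|i]; last exact: IH.
  by move: W1; rewrite drop0 /= -take_morph //; apply: trib_morph_gt0.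
- case: i => [|i]; last exact: IH.
  by move: W1; rewrite drop0 /= -take_morph //; apply: trib_morph_gt0.
Qed.

Definition trib_windows : seq (seq 'I_3) := undup (windows 8 (trib_prefix 7)).

Lemma trib_windows_closed : trib_closed 8 trib_windows.
Proof. by vm_compute. Qed.

Lemma trib_prefix_windows n : windows_in 8 trib_windows (trib_prefix n).
Proof.
elim: n => [|n IH]; first by case=> [|i]; vm_compute.
exact: windows_in_morph trib_windows_closed IH.
Qed.

(** Truncated windows are exempt, since [nth] could return its default there. *)
Lemma trib_windows_pseudoperiod :
  all (fun v => (size v == 8) ==>
         (nth l0 v 0 \in [seq nth l0 v q | q <- [:: 4; 6; 7]])) trib_windows.
Proof. by vm_compute. Qed.

Lemma trib_word_3pseudoperiodic : pseudoperiodic 3 trib_word.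
Proof.
exists [:: 4; 6; 7]; split=> //; split=> // i.
(* This prefix is long enough for the window at [i] to have all 8 letters. *)
have szi := size_trib_prefix (i + 7).
have := allP trib_windows_pseudoperiod _ (trib_prefix_windows (i + 7) i).
rewrite size_takel ?size_drop ?ltn_subRL //= !nth_take // !nth_drop.
have wE k : k <= 7 -> nth l0 (trib_prefix (i + 7)) (i + k) = trib_word (i + k).
  by move=> k7; rewrite -trib_wordE // (leq_ltn_trans _ szi) // leq_add2l.
by rewrite !wE // addn0.
Qed.

Theorem theorem28 (t : infword 'I_3) (ht : is_tribonacci t) :
  pseudoperiodic 3 t /\ ~ pseudoperiodic 2 t.
Proof.
have E := tribonacci_unique ht trib_word_tribonacci.
have transfer (s s' : infword 'I_3) k :
    s =1 s' -> pseudoperiodic k s -> pseudoperiodic k s'.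
  move=> Es [p [szp [p0 ltp Hp]]]; exists p; split=> //; split=> // i.
  by rewrite -Es -(eq_map (fun q => Es (i + q))).
split; first exact: transfer (fsym E) trib_word_3pseudoperiodic.
by move/(transfer _ _ _ E)/trib_word_not_2pseudoperiodic.
Qed.
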